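(* Let $\mathcal{Z}=\{z_1,\dots,z_{|\mathcal{Z}|}\}$ be a given finite set of measurements, with given state and landmark priors $\mathcal{X}^{i}$ and $\mathcal{L}^{i}=\{l_1,\dots,l_{|\mathcal{L}^i|}\}$. Let $\mathbb{A}$ be the finite set of all possible assignments of measurements to landmarks, and for $\mathcal{A}\in\mathbb{A}$ let $p(\mathcal{A}) := p(\mathcal{Z}\mid\mathcal{X}^{i},\mathcal{L}^{i},\mathcal{A})\ge 0$ be its likelihood. Let $\overline{\mathbb{A}}\subseteq\mathbb{A}$ be a set of the $K$ highest-probability assignments (that is, $|\overline{\mathbb{A}}|=K$ and $p(\mathcal{A})\ge p(\mathcal{A}')$ for all $\mathcal{A}\in\overline{\mathbb{A}}$ and $\mathcal{A}'\in\mathbb{A}\setminus\overline{\mathbb{A}}$), with $\sum_{\mathcal{A}\in\overline{\mathbb{A}}}p(\mathcal{A})>0$. Let $\beta:2^{\mathbb{A}}\to\mathbb{R}^{+}$ satisfy $$\beta(\overline{\mathbb{A}})\;\ge\;\sum_{\mathcal{A}\in\mathbb{A}\setminus\overline{\mathbb{A}}}p(\mathcal{A}),$$ and let $$\gamma(\overline{\mathbb{A}}) := \frac{\beta(\overline{\mathbb{A}})}{\beta(\overline{\mathbb{A}})+\sum_{\mathcal{A}\in\overline{\mathbb{A}}}p(\mathcal{A})}.$$ For each measurement $z_k$ and landmark $l_j$, let $$w_{kj}^{i} := \frac{\sum_{\mathcal{A}\in\mathbb{A}_{(k,j)}}p(\mathcal{A})}{\sum_{\mathcal{A}\in\mathbb{A}}p(\mathcal{A})},\qquad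 \bar{w}_{kj}^{i} := \frac{\sum_{\mathcal{A}\in\overline{\mathbb{A}}_{(k,j)}}p(\mathcal{A})}{\sum_{\mathcal{A}\in\overline{\mathbb{A}}}p(\mathcal{A})}$$ be the true and the approximate association probabilities, where $\mathbb{A}_{(k,j)}\subseteq\mathbb{A}$ and $\overline{\mathbb{A}}_{(k,j)}\subseteq\overline{\mathbb{A}}$ are the subsets of assignments that assign measurement $z_k$ to landmark $l_j$. Then for every measurement index $k$ and landmark index $j$, $$w_{kj}^{i}\in\left[\bar{w}_{kj}^{i}-\gamma(\overline{\mathbb{A}}),\;\bar{w}_{kj}^{i}+\gamma(\overline{\mathbb{A}})\right].$$
   Context: Setting: simultaneous localisation and mapping (SLAM) with unknown data association. $\mathcal{X}^i$ is a given estimate of the sequence of robot states, $\mathcal{L}^i$ a given estimate of the landmark states, and $\mathcal{Z}$ the measurements, all fixed throughout. Each measurement is generated by at most one landmark. An assignment $\mathcal{A}$ encodes which landmark (if any) each measurement is assigned to, i.e. it is a partial function from measurement indices to landmark indices. $\mathbb{A}$ is the (finite) set of all possible assignments under consideration; no particular assignment model is imposed. The quantity $p(\mathcal{A}) := p(\mathcal{Z}\mid\mathcal{X}^{i},\mathcal{L}^{i},\mathcal{A})$ is the nonnegative likelihood of the measurements given the states, the landmarks and the assignment; it need not sum to $1$ over $\mathbb{A}$. The set $\overline{\mathbb{A}}_{(k,j)}=\overline{\mathbb{A}}\cap\mathbb{A}_{(k,j)}$ is the subset of the $K$ likeliest assignments which assign $z_k$ to $l_j$ (not the $K$ likeliest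 assignments among those which assign $z_k$ to $l_j$). $2^{\mathbb{A}}$ denotes the power set of $\mathbb{A}$. The marginal assignment probability is $\sum_{\mathcal{A}\in\mathbb{A}_{(k,j)}}p(\mathcal{A}\mid\mathcal{X}^i,\mathcal{L}^i,\mathcal{Z})$. By Bayes' rule, under the standing assumption that the prior $p(\mathcal{A}\mid\mathcal{X}^i,\mathcal{L}^i)$ is uniform over $\mathbb{A}$, it equals the ratio given as the definition of $w_{kj}^i$ in the claim. The quantity $\gamma(\overline{\mathbb{A}})$ is called the association error bound. *)

(* Defs.v *)
From HB Require Import structures.
From mathcomp Require Import all_boot all_order all_algebra.

Set Implicit Arguments.
Unset Strict Implicit.
Unset Printing Implicit Defensive.

Import Order.TTheory GRing.Theory Num.Theory.
Local Open Scope ring_scope.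

(* Each measurement is generated by at most one landmark, so an assignment is
   a partial function from measurement indices to landmark indices; [None]
   means that the measurement is assigned to no landmark. *)
Definition assignment (m n : nat) := {ffun 'I_m -> option 'I_n}.

Definition assigning m n (A : {set assignment m n}) (k : 'I_m) (j : 'I_n) :
    {set assignment m n} :=
  [set a in A | a k == Some j].

(* Ties are allowed, so a set of the [K] likeliest elements of [A] need not be
   unique. *)
Definition likeliest (R : realFieldType) m n (p : assignment m n -> R)
    (A : {set assignment m n}) (K : nat) (B : {set assignment m n}) : Prop :=
  [/\ B \subset A, #|B| = K
    & forall a a', a \in B -> a' \in A :\: B -> p a' <= p a].

(* With [A] the set of all assignments this is the true probability [w_kj];
   with the set of the [K] likeliest ones it is the approximation [wbar_kj]. *)
Definition assoc_prob (R : realFieldType) m n (p : assignment m n -> R)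
    (A : {set assignment m n}) (k : 'I_m) (j : 'I_n) : R :=
  (\sum_(a in assigning A k j) p a) / (\sum_(a in A) p a).

Definition assoc_error_bound (R : realFieldType) m n (p : assignment m n -> R)
    (beta : {set assignment m n} -> R) (B : {set assignment m n}) : R :=
  beta B / (beta B + \sum_(a in B) p a).

(* Main.v *)
Require Import Defs.
From HB Require Import structures.
From mathcomp Require Import all_boot all_order all_algebra.
From mathcomp Require Import ring lra.

Set Implicit Arguments.
Unset Strict Implicit.
Unset Printing Implicit Defensive.

Import Order.TTheory GRing.Theory Num.Theory.
Local Open Scope ring_scope.

(* Dropping the tail A :\: Abar, of mass T, moves the ratio by
   (t - wbar * T) / (S + T), where S is the mass of Abar and t the part of the
   tail that assigns z_k to l_j. Both t and wbar * T lie in [0, T], so the error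
   is at most T / (S + T), which is increasing in T and hence at most gamma. *)

(** Clearing the two positive denominators and cancelling [T * b] leaves [T * S <= b * S]. *)
Lemma mass_fraction_le (R : realFieldType) (S T b : R) :
  0 < S -> 0 <= T -> T <= b -> T / (S + T) <= b / (b + S).
Proof.
move=> S_gt0 T_ge0 leTb; rewrite ler_pdivrMr; last by lra.
by rewrite mulrAC ler_pdivlMr; [nra | lra].
Qed.

Lemma ratio_extend_dist (R : realFieldType) (s S t T : R) :
  0 < S -> 0 <= s <= S -> 0 <= t <= T ->
  `|(s + t) / (S + T) - s / S| <= T / (S + T).
Proof.
move=> S_gt0 /andP[s_ge0 leSs] /andP[t_ge0 letT].
have ST_gt0 : 0 < S + T by lra.
have -> : (s + t) / (S + T) - s / S = (t - s / S * T) / (S + T).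
  by field; rewrite !gt_eqF.
have q_ge0 : 0 <= s / S by rewrite divr_ge0 // ltW.
have q_le1 : s / S <= 1 by rewrite ler_pdivrMr // mul1r.
rewrite normrM normfV (gtr0_norm ST_gt0) ler_pM2r ?invr_gt0 // ler_norml.
(* With [q = s / S] in [0, 1] and [T >= 0], the product [q * T] lies in [0, T]. The lower bound then
   uses [0 <= t], the upper one [t <= T]. *)
by apply/andP; split; nra.
Qed.

(** Applied both to [Abar] and to the tail [A :\: Abar], it supplies the two range hypotheses of
    [ratio_extend_dist]. *)
Lemma sum_assigning_bounds (R : realFieldType) m n (p : assignment m n -> R)
    (A : {set assignment m n}) (k : 'I_m) (j : 'I_n) :
  (forall a, a \in A -> 0 <= p a) ->
  0 <= \sum_(a in assigning A k j) p a <= \sum_(a in A) p a.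
Proof.
move=> p_ge0; apply/andP; split.
  by apply: sumr_ge0 => a; rewrite inE => /andP[/p_ge0].
rewrite [leRHS](big_setID (assigning A k j)) /=.
rewrite (setIidPr _) ?lerDl; last by apply/subsetP => a; rewrite inE => /andP[].
by apply: sumr_ge0 => a; rewrite inE => /andP[_ /p_ge0].
Qed.

(** Assigning [k] to [j] is a condition on each assignment separately, so it is compatible with
    splitting [A] into [B] and its complement in [A]. *)
Lemma sum_assigning_setD (R : realFieldType) m n (p : assignment m n -> R)
    (A B : {set assignment m n}) (k : 'I_m) (j : 'I_n) :
  B \subset A ->
  \sum_(a in assigning A k j) p a =
    \sum_(a in assigning B k j) p a + \sum_(a in assigning (A :\: B) k j) p a.
Proof.
move=> /subsetP sBA; rewrite (big_setID B) /=; congr (_ + _).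
  apply: eq_bigl => a; rewrite !inE andbC.
  by case: (boolP (a \in B)) => // /sBA ->.
by apply: eq_bigl => a; rewrite !inE andbA.
Qed.

Theorem theorem1 (R : realFieldType)
    (Meas States Landmark : Type) (m n : nat)
    (lik : m.-tuple Meas -> States -> n.-tuple Landmark ->
           assignment m n -> R)
    (Z : m.-tuple Meas) (X : States) (L : n.-tuple Landmark)
    (A : {set assignment m n})
    (p_ge0 : forall a, a \in A -> 0 <= lik Z X L a)
    (K : nat) (Abar : {set assignment m n})
    (Abar_likeliest : likeliest (lik Z X L) A K Abar)
    (Abar_gt0 : 0 < \sum_(a in Abar) lik Z X L a)
    (beta : {set assignment m n} -> R)
    (beta_ge0 : forall B : {set assignment m n}, B \subset A -> 0 <= beta B)
    (beta_bound : \sum_(a in A :\: Abar) lik Z X L a <= beta Abar)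
    (k : 'I_m) (j : 'I_n) :
  let p := lik Z X L in
  let w := assoc_prob p A k j in
  let wbar := assoc_prob p Abar k j in
  let gamma := assoc_error_bound p beta Abar in
  w \in `[wbar - gamma, wbar + gamma].
Proof.
cbv zeta; have [sBA _ _] := Abar_likeliest.
set p := lik Z X L in p_ge0 Abar_gt0 beta_bound *.
have p_geB a : a \in Abar -> 0 <= p a by move/(subsetP sBA)/p_ge0.
have p_geD a : a \in A :\: Abar -> 0 <= p a by rewrite inE => /andP[_ /p_ge0].
have sumA : \sum_(a in A) p a =
    \sum_(a in Abar) p a + \sum_(a in A :\: Abar) p a.
  by rewrite (big_setID Abar) /= (setIidPr sBA).
have tail_ge0 : 0 <= \sum_(a in A :\: Abar) p a by apply: sumr_ge0.
rewrite in_itv /= -ler_distl.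
(* The unknown tail mass is at most [beta Abar], so it suffices to bound the distance by the exact
   tail fraction instead of [gamma]. *)
apply: le_trans (mass_fraction_le Abar_gt0 tail_ge0 beta_bound).
rewrite /assoc_prob sumA (sum_assigning_setD p k j sBA).
by apply: ratio_extend_dist => //; apply: sum_assigning_bounds.
Qed.
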